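(* Let $k,r\in\mathbb{N}$ with $k\ge 1$ and $r\geq 2$. For each integer $n\ge r$, let $\Gamma_{1,n}$ be the disjoint union of $k$ copies of the $r$-complete hypergraph on $n$ nodes, and let $\Gamma_{2,n}$ be an oriented hypergraph that differs from $\Gamma_{1,n}$ by at most $c_1$ hyperedges of cardinality at most $c_2$, where $c_1=c_1(n)$ and $c_2=c_2(n)$ satisfy $c_1\cdot c_2=o(n)$. Let $Q$ be one of the operators $A$, $D$, $K$, $L$ and let $\mu_{1,n}:=\mu(Q(\Gamma_{1,n}))$, $\mu_{2,n}:=\mu(Q(\Gamma_{2,n}))$ be the corresponding spectral measures. Then $$d_{\mathrm{tv}}(\mu_{1,n},\mu_{2,n})\longrightarrow 0\quad\text{as } n\to\infty .$$
   Context: An oriented hypergraph is a triple $\Gamma=(V,H,\psi)$ where $V$ is a finite set of vertices (nodes), $H$ is a finite multiset of nonempty subsets $h\subseteq V$ called hyperedges (repeated hyperedges are distinct elements of $H$), and $\psi:V\times H\to\{-1,0,+1\}$ satisfies $\psi(i,h)\neq 0\iff i\in h$. Two vertices $i\ne j$ are co-oriented in $h$ if $\psi(i,h)=\psi(j,h)\neq0$, and anti-oriented in $h$ if $\psi(i,h)=-\psi(j,h)\neq0$. The degree $\deg(i)$ is the number of hyperedges containing $i$; the cardinality of $h$ is its number of vertices. Standing assumption: no vertex has degree zero. For $\Gamma$ on $N$ vertices: $D(\Gamma)=\mathrm{diag}(\deg(1),\dots,\deg(N))$; $A(\Gamma)$ is the $N\times N$ matrix with $A_{ii}=0$ and, for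 $i\neq j$, $A_{ij}=\#\{\text{hyperedges in which } i,j \text{ are anti-oriented}\}-\#\{\text{hyperedges in which } i,j\text{ are co-oriented}\}$; $L(\Gamma)=\mathrm{Id}-D^{-1/2}AD^{-1/2}$; $K(\Gamma)=D-A$. All are real symmetric. The $r$-complete hypergraph on $n$ nodes ($r\ge2$) has $n$ vertices, its hyperedges are all $\binom nr$ vertex subsets of cardinality $r$ (each once), and $\psi(i,h)=+1$ whenever $i\in h$. Two oriented hypergraphs $\Gamma_1=(V,H_1,\psi_{1})$ and $\Gamma_2=(V,H_2,\psi_{2})$ on the same vertex set differ at most by $c$ hyperedges if there are multisets $\hat H,\hat H_1,\hat H_2$ of nonempty subsets of $V$ with $H_1=\hat H\sqcup\hat H_1$, $H_2=\hat H\sqcup\hat H_2$, $\psi_1=\psi_2$ on $V\times\hat H$, and $\#(\hat H_1\cup\hat H_2)\le c$, i.e. at most $c$ hyperedges (counted with multiplicity) in total belong to $\hat H_1$ or $\hat H_2$. They differ at most by $c_1$ hyperedges of cardinality at most $c_2$ if this holds with $c=c_1$ and every hyperedge in $\hat H_1$ and $\hat H_2$ has cardinality at most $c_2$. The spectral measure of an $N\times N$ real symmetric matrix $Q$ with eigenvalues $\lambda_1(Q)\le\dots\le\lambda_N(Q)$ is $\mu(Q)=\frac1N\sum_{i=1}^N\delta_{\lambda_i(Q)}$, where $\delta$ denotes the Dirac measure. The total variation distance is $d_{\mathrm{tv}}(\mu_1,\mu_2)=\sup_{B}|\mu_1(B)-\mu_2(B)|$, the supremum over measurable (Borel) $B\subseteq\mathbb{R}$.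 *)

(* Defs.v *)
From HB Require Import structures.
From mathcomp Require Import all_boot all_order all_algebra.
From mathcomp Require Import all_classical all_reals all_analysis.
From mathcomp Require polyrcf.

Set Implicit Arguments.
Unset Strict Implicit.
Unset Printing Implicit Defensive.

Import Order.TTheory GRing.Theory Num.Theory.
Import numFieldNormedType.Exports.

Local Open Scope classical_set_scope.
Local Open Scope ring_scope.

(* The multiset of hyperedges is represented by a finite type of edge labels
   together with the vertex set of each label, so that repeated hyperedges are
   distinct labels and may carry different orientations. *)
Record ohypergraph (V : finType) := OHypergraph {
  hedge : finType;
  hset : hedge -> {set V};
  orient : V -> hedge -> int;
  hset_neq0 : forall h, hset h != finset.set0;
  orient_val : forall i h, orient i h \in [:: -1; 0; 1];
  orient_neq0 : forall i h, (orient i h != 0) = (i \in hset h)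
}.

Section Operators.
Context (V : finType) (G : ohypergraph V).

Definition hdeg (i : V) : nat := #|[set h : hedge G | i \in hset h]%SET|.

Definition no_isolated : Prop := forall i : V, (0 < hdeg i)%N.

Definition co_oriented (i j : V) (h : hedge G) : bool :=
  (orient i h == orient j h) && (orient i h != 0).

Definition anti_oriented (i j : V) (h : hedge G) : bool :=
  (orient i h == - orient j h) && (orient i h != 0).

(* The matrices below are indexed by 'I_#|V|, through the enumeration of V. *)

Definition degree_mx (R : realType) : 'M[R]_#|V| :=
  diag_mx (\row_i (hdeg (enum_val i))%:R).

Definition adjacency_mx (R : realType) : 'M[R]_#|V| :=
  \matrix_(i, j)
    if i == j then 0
    else #|[set h | anti_oriented (enum_val i) (enum_val j) h]%SET|%:R
       - #|[set h | co_oriented (enum_val i) (enum_val j) h]%SET|%:R.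

Definition degree_invsqrt_mx (R : realType) : 'M[R]_#|V| :=
  diag_mx (\row_i (Num.sqrt (hdeg (enum_val i))%:R)^-1).

Definition normalized_laplacian_mx (R : realType) : 'M[R]_#|V| :=
  1%:M - degree_invsqrt_mx R *m adjacency_mx R *m degree_invsqrt_mx R.

Definition kirchhoff_mx (R : realType) : 'M[R]_#|V| :=
  degree_mx R - adjacency_mx R.

End Operators.

Inductive hoperator := OpA | OpD | OpK | OpL.

Definition operator_mx (R : realType) (V : finType) (Q : hoperator)
    (G : ohypergraph V) : 'M[R]_#|V| :=
  match Q with
  | OpA => adjacency_mx G R
  | OpD => degree_mx G R
  | OpK => kirchhoff_mx G R
  | OpL => normalized_laplacian_mx G R
  end.

Section RComplete.
Context (r : nat) (r_ge2 : (2 <= r)%N) (n : nat).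

Definition rcomplete_edge : finType := {h : {set 'I_n} | #|h| == r}.

Definition rcomplete_orient (i : 'I_n) (h : rcomplete_edge) : int :=
  if i \in val h then 1 else 0.

Fact rcomplete_hset_neq0 (h : rcomplete_edge) : val h != finset.set0.
Proof.
by rewrite -card_gt0 (eqP (valP h)); exact: leq_trans r_ge2.
Qed.

Fact rcomplete_orient_val (i : 'I_n) (h : rcomplete_edge) :
  rcomplete_orient i h \in [:: -1; 0; 1].
Proof. by rewrite /rcomplete_orient; case: ifP. Qed.

Fact rcomplete_orient_neq0 (i : 'I_n) (h : rcomplete_edge) :
  (rcomplete_orient i h != 0) = (i \in val h).
Proof. by rewrite /rcomplete_orient; case: ifP. Qed.

Definition rcomplete : ohypergraph 'I_n :=
  OHypergraph rcomplete_hset_neq0 rcomplete_orient_val rcomplete_orient_neq0.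

End RComplete.

Section Copies.
Context (k : nat) (V : finType) (G : ohypergraph V).

Definition copies_edge : finType := ('I_k * hedge G)%type.

Definition copies_hset (h : copies_edge) : {set 'I_k * V} :=
  finset.setX (finset.set1 h.1) (hset h.2).

Definition copies_orient (i : 'I_k * V) (h : copies_edge) : int :=
  if i.1 == h.1 then orient i.2 h.2 else 0.

Fact copies_hset_neq0 (h : copies_edge) : copies_hset h != finset.set0.
Proof.
by rewrite -card_gt0 cardsX cards1 mul1n card_gt0 hset_neq0.
Qed.

Fact copies_orient_val (i : 'I_k * V) (h : copies_edge) :
  copies_orient i h \in [:: -1; 0; 1].
Proof.
by rewrite /copies_orient; case: ifP => // _; exact: orient_val.
Qed.

Fact copies_orient_neq0 (i : 'I_k * V) (h : copies_edge) :
  (copies_orient i h != 0) = (i \in copies_hset h).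
Proof.
case: i => a v; rewrite /copies_orient /copies_hset.
rewrite finset.in_setX finset.in_set1 /=.
by case: (a == h.1) => /=; first exact: orient_neq0.
Qed.

Definition disjoint_copies : ohypergraph ('I_k * V)%type :=
  OHypergraph copies_hset_neq0 copies_orient_val copies_orient_neq0.

End Copies.

(* E, E1, E2 are the label types of the multisets written \hat H, \hat H_1,
   \hat H_2 in H_1 = \hat H + \hat H_1 and H_2 = \hat H + \hat H_2; the two
   bijections are these decompositions. *)
Definition differ_at_most (V : finType) (G1 G2 : ohypergraph V)
    (c1 c2 : nat) : Prop :=
  exists (E E1 E2 : finType)
         (f1 : E + E1 -> hedge G1) (f2 : E + E2 -> hedge G2),
    [/\ bijective f1, bijective f2,
        (forall e : E, hset (f1 (inl e)) = hset (f2 (inl e))) /\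
        (forall (i : V) (e : E),
           orient i (f1 (inl e)) = orient i (f2 (inl e))),
        (#|E1| + #|E2| <= c1)%N &
        (forall e : E1, (#|hset (f1 (inr e))| <= c2)%N) /\
        (forall e : E2, (#|hset (f2 (inr e))| <= c2)%N)].

Section Spectral.
Context (R : realType).

(* The real roots of the characteristic polynomial in increasing order, each
   repeated according to its multiplicity. For a symmetric N x N matrix this
   list has exactly N terms, so the default value in [eigval] is never used. *)
Definition eigenvalues (N : nat) (Q : 'M[R]_N) : seq R :=
  flatten [seq nseq (mup x (char_poly Q)) x
          | x <- polyrcf.rootsR (char_poly Q)].

Definition eigval (N : nat) (Q : 'M[R]_N) (i : nat) : R :=
  nth 0 (eigenvalues Q) i.

Definition spectral_measure (N : nat) (Q : 'M[R]_N) :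
    {measure set (measurableTypeR R) -> \bar R} :=
  mscale (N%:R^-1)%:nng
    (msum (fun i => dirac (eigval Q i : measurableTypeR R)) N).

Definition dtv (mu1 mu2 : {measure set (measurableTypeR R) -> \bar R}) :
    \bar R :=
  ereal_sup [set `|mu1 B - mu2 B|%E | B in
              (measurable : set (set (measurableTypeR R)))].

End Spectral.

(* Main.v *)
(* Outside the set S of the at most c1 * c2 vertices lying in an altered
   hyperedge, the entries of Q(Gamma_2) agree with those of Q(Gamma_1), which
   have the form alpha [i = j] + beta [i, j in the same copy]. Hence
   Q(Gamma_2) - alpha has rank at most k + 2|S|, so alpha is an eigenvalue of
   multiplicity at least kn - (k + 2 c1 c2); the same holds for Q(Gamma_1). Both
   spectral measures are thus within (k + 2 c1 c2) / (kn) of the Dirac mass at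
   alpha. *)
Require Import Defs.
From mathcomp Require Import all_boot all_order all_algebra.
From mathcomp Require Import all_classical all_reals all_analysis.
From mathcomp Require polyrcf.
From mathcomp Require Import zify ring lra.

Set Implicit Arguments.
Unset Strict Implicit.
Unset Printing Implicit Defensive.

Import Order.TTheory GRing.Theory Num.Theory.
Import numFieldNormedType.Exports.
Local Open Scope classical_set_scope.
Local Open Scope ring_scope.

(** * Rank defect and multiplicity in the list of eigenvalues *)

(* Left multiplication by P, the inverse of the column basis change, kills the
   rows of Q - a of index at least the rank; the corresponding rows of
   P ('X - Q) are thus multiples of 'X - a. *)
Lemma mup_char_poly (F : fieldType) (N : nat) (Q : 'M[F]_N) (a : F) :
  (N - \rank (Q - a%:M)%R <= mup a (char_poly Q))%N.
Proof.
have chQ0 : char_poly Q != 0 by rewrite monic_neq0 // char_poly_monic.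
rewrite mup_geq //; set M := Q - a%:M; set rk := \rank M.
set P := invmx (col_ebase M); set t := 'X - a%:P.
have PM (i j : 'I_N) : (rk <= i)%N -> (P *m M) i j = 0.
  move=> rki; rewrite -[X in _ *m X]mulmx_ebase -/rk !mulmxA mulVmx ?col_ebase_unit //.
  rewrite mul1mx !mxE big1 // => l _.
  by rewrite !mxE [(i < rk)%N]ltnNge rki andbF mul0r.
have PQ (i j : 'I_N) : (rk <= i)%N -> (P *m Q) i j = a * P i j.
  by move=> /(PM i j); rewrite mulmxBr mul_mx_scalar !mxE => /subr0_eq.
have mapPE : map_mx polyC P *m char_poly_mx Q =
    diag_mx (\row_i if (i < rk)%N then 1 else t) *m
    \matrix_(i, j) (if (i < rk)%N
                    then (map_mx polyC P *m char_poly_mx Q) i j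
                    else (P i j)%:P).
  apply/matrixP => i j; rewrite mul_diag_mx !mxE.
  case: ifPn => [_|]; first by rewrite mul1r.
  rewrite -leqNgt => rki.
  rewrite (_ : \sum_l _ = (map_mx polyC P *m char_poly_mx Q) i j); last by rewrite mxE.
  rewrite mulmxBr mul_mx_scalar -map_mxM !mxE -/(P *m Q) mulrBl.
  by rewrite -polyCM -PQ // mxE.
have detP : \det P != 0 by rewrite -unitfE -unitmxE unitmx_inv col_ebase_unit.
(* In the determinant each of the [N - rk] last rows gives a factor [t]; [\det P] is a nonzero
   constant and does not affect divisibility. *)
have : t ^+ (N - rk) %| (\det P)%:P * char_poly Q.
  rewrite /char_poly -det_map_mx -det_mulmx mapPE det_mulmx dvdp_mulr //.
  rewrite det_diag (bigID (fun i : 'I_N => (i < rk)%N)) /= dvdp_mull //.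
  rewrite (eq_bigr (fun=> t)) => [|i /negPf Hi]; last by rewrite !mxE Hi.
  rewrite prodr_const dvdp_exp2l //.
  have := cardC (fun i : 'I_N => (i < rk)%N); rewrite card_ord.
  suff -> : #|(fun i : 'I_N => (i < rk)%N)| = rk.
    by move=> cN; rewrite -[X in (X - _)%N]cN addKn.
  have rkN : (rk <= N)%N by exact: rank_leq_row.
  rewrite -sum1_card -[RHS]card_ord -[RHS]sum1_card.
  by rewrite (big_ord_widen N (fun=> 1%N) rkN).
by rewrite mul_polyC dvdpZr.
Qed.

(** Powers of ['X - x] for distinct [x] are pairwise coprime, so their separate divisibilities
    multiply. *)
Lemma prod_XsubC_mup_dvdp (F : fieldType) (p : {poly F}) (s : seq F) :
  p != 0 -> uniq s -> \prod_(x <- s) ('X - x%:P) ^+ mup x p %| p.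
Proof.
move=> p0; elim: s => [|x s IHs] /=; first by rewrite big_nil dvd1p.
case/andP=> xs us; rewrite big_cons Gauss_dvdp; last first.
  rewrite coprimep_expl // coprimep_sym coprimep_XsubC.
  rewrite /root horner_prod prodf_seq_neq0; apply/allP => y ys /=.
  rewrite horner_exp hornerXsubC expf_neq0 // subr_eq0.
  by apply: contraNneq xs => ->.
by rewrite IHs // -mup_geq // leqnn.
Qed.

(** The product of ['X - x] over the list divides the characteristic polynomial, of degree [N].
    Hence reading the first [N] entries truncates nothing. *)
Lemma size_eigenvalues (R : realType) (N : nat) (Q : 'M[R]_N) :
  (size (eigenvalues Q) <= N)%N.
Proof.
have chQ0 : char_poly Q != 0 by rewrite monic_neq0 // char_poly_monic.
rewrite -ltnS -(size_char_poly Q) -(size_prod_XsubC (eigenvalues Q) id).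
apply: dvdp_leq => //; rewrite /eigenvalues big_flatten big_map.
under eq_bigr => x _ do rewrite big_nseq -Monoid.iteropE /=.
apply: prod_XsubC_mup_dvdp => //.
exact: (sorted_uniq lt_trans ltxx (polyrcf.sorted_roots _ _ _)).
Qed.

Lemma count_eigenvalues (R : realType) (N : nat) (Q : 'M[R]_N) (a : R) :
  (mup a (char_poly Q) <= count_mem a (eigenvalues Q))%N.
Proof.
have chQ0 : char_poly Q != 0 by rewrite monic_neq0 // char_poly_monic.
have [|m0] := posnP (mup a (char_poly Q)); first by move=> ->.
have: a \in polyrcf.rootsR (char_poly Q).
  by rewrite -(polyrcf.roots_on_rootsR chQ0) /= -dvdp_XsubCl XsubC_dvd.
rewrite /eigenvalues => /path.splitPr[s1 s2].
rewrite map_cat flatten_cat count_cat /= count_cat count_nseq /= eqxx mul1n.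
lia.
Qed.

Lemma card_eigval_neq (R : realType) (N : nat) (Q : 'M[R]_N) (a : R) :
  (#|[set i : 'I_N | eigval Q i != a]%SET| <= \rank (Q - a%:M)%R)%N.
Proof.
have rkN := rank_leq_row (Q - a%:M).
have h1 : (N - \rank (Q - a%:M)%R <= count_mem a (eigenvalues Q))%N.
  exact: leq_trans (mup_char_poly Q a) (count_eigenvalues Q a).
have h3 := size_eigenvalues Q.
have h4 : (count_mem a (eigenvalues Q) <= #|[set i : 'I_N | eigval Q i == a]%SET|)%N.
  rewrite cardsE cardE size_filter /enum_mem -enumT.
  rewrite -(mkseq_nth 0 (eigenvalues Q)) count_map.
  have -> : count (fun i : 'I_N => eigval Q i == a) (enum 'I_N) =
    count (fun i => eigval Q i == a) (iota 0 N).
    by rewrite -val_enum_ord count_map.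
  (* Indices beyond the end of the list read the default 0, which can only add occurrences of
     [a]. *)
  by rewrite -[X in (_ <= count _ (iota 0 X))%N](subnKC h3) iotaD count_cat leq_addr.
have := cardsC [set i : 'I_N | eigval Q i == a]%SET.
rewrite card_ord (_ : finset.setC _ = [set i : 'I_N | eigval Q i != a]%SET); last first.
  by apply/finset.setP => i; rewrite !inE.
lia.
Qed.

(** * Total variation distance of spectral measures *)

Lemma spectral_measureE (R : realType) (N : nat) (Q : 'M[R]_N) (B : set R) :
  spectral_measure Q B =
  (N%:R^-1 * \sum_(i < N) (\1_B (eigval Q i) : R))%:E.
Proof.
rewrite /spectral_measure /mscale /= /msum EFinM; congr (_ * _)%E.
by rewrite -sumEFin; apply: eq_bigr.
Qed.

(** Only indices with [eigval Q i != a] contribute to the difference, each by at most 1. *)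
Lemma dist_sum_indic_eigval (R : realType) (N : nat) (Q : 'M[R]_N) (a : R)
    (B : set R) :
  `|\sum_(i < N) (\1_B (eigval Q i) : R) - N%:R * \1_B a|
    <= (\rank (Q - a%:M))%:R.
Proof.
have -> : N%:R * \1_B a = \sum_(i < N) \1_B a :> R.
  by rewrite sumr_const card_ord mulr_natl.
rewrite -sumrB; apply: le_trans (ler_norm_sum _ _ _) _.
apply: (@le_trans _ _ (\sum_(i < N) (eigval Q i != a)%:R)).
  apply: ler_sum => i _; case: eqVneq => [->|_] /=; first by rewrite subrr normr0.
  by rewrite !indicE; case: (_ \in B); case: (_ \in B);
     rewrite ?subrr ?subr0 ?sub0r ?normrN ?normr0 ?normr1.
rewrite -natr_sum ler_nat; apply: leq_trans (card_eigval_neq Q a).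
by rewrite -sum1_card [leqRHS]big_mkcond /=; apply: leq_sum => i _; rewrite inE; case: (_ != _).
Qed.

Lemma dtv_ge0 (R : realType) (mu1 mu2 : {measure set (measurableTypeR R) -> \bar R}) :
  (0 <= dtv mu1 mu2)%E.
Proof.
by apply: ereal_sup_ubound; exists set0 => //; rewrite !measure0 sube0 abse0.
Qed.

(** Triangle inequality through the Dirac mass at [a], uniformly in the set [B]. *)
Lemma dtv_spectral_measure (R : realType) (N : nat) (Q1 Q2 : 'M[R]_N) (a : R)
    (m : nat) :
  (\rank (Q1 - a%:M)%R <= m)%N -> (\rank (Q2 - a%:M)%R <= m)%N ->
  (dtv (spectral_measure Q1) (spectral_measure Q2) <= ((2 * m)%:R / N%:R)%:E)%E.
Proof.
move=> rk1 rk2; apply: ge_ereal_sup => _ [B _ <-].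
rewrite !spectral_measureE -EFinB abse_EFin lee_fin -mulrBr normrM mulrC.
rewrite [X in _ * X]ger0_norm ?invr_ge0 // ler_wpM2r ?invr_ge0 //.
have H (Q : 'M[R]_N) := dist_sum_indic_eigval Q a B.
rewrite -(subrKA (N%:R * \1_B a)) (le_trans (ler_normD _ _)) // mul2n -addnn natrD.
by rewrite lerD //; [|rewrite distrC]; rewrite (le_trans (H _)) // ler_nat.
Qed.

(** * Rank of matrices that are block constant off a small index set *)

Lemma rank_diag_mem (F : fieldType) (N : nat) (S : {set 'I_N}) :
  (\rank (diag_mx (\row_i (i \in S)%:R) : 'M[F]_N) <= #|S|)%N.
Proof.
have -> : diag_mx (\row_i (i \in S)%:R) = \sum_(i in S) delta_mx i i :> 'M[F]_N.
  apply/matrixP => i j; rewrite !mxE summxE.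
  under eq_bigr do rewrite mxE.
  have [iS|iS] := boolP (i \in S).
    rewrite (bigD1 i) //= eqxx big1 ?addr0 => [|l /andP[_ li]]; first by rewrite eq_sym.
    by rewrite eq_sym (negPf li).
  rewrite mul0rn big1 // => l lS.
  by case: eqVneq => // il; rewrite il lS in iS.
rewrite -sum1_card.
apply: (big_ind2 (fun (A : 'M[F]_N) n => (\rank A <= n)%N)) => [|A1 n1 A2 n2 h1 h2|i _].
- by rewrite mxrank0.
- by rewrite (leq_trans (mxrank_add _ _)) // leq_add.
- by rewrite mxrank_delta.
Qed.

(** [M] splits into its rows in [S], its remaining columns in [S], and the rest. The first two parts
    have rank at most [#|S|] each; the last factors through the [k] block indicators. *)
Lemma rank_block_outside (F : fieldType) (N k : nat) (M : 'M[F]_N)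
    (S : {set 'I_N}) (blk : 'I_N -> 'I_k) (b : F) :
  (forall i j, i \notin S -> j \notin S -> M i j = b * (blk i == blk j)%:R) ->
  (\rank M <= k + 2 * #|S|)%N.
Proof.
(* [D s] projects onto the coordinates in [s]; [C] is the incidence matrix of indices and blocks, so
   [C *m C^T] is the same-block matrix. *)
move=> MS; pose D (s : {set 'I_N}) : 'M[F]_N := diag_mx (\row_i (i \in s)%:R).
pose C : 'M[F]_(N, k) := \matrix_(i, l) (blk i == l)%:R.
have -> : M = D S *m M + D (finset.setC S) *m (M *m D S)
              + D (finset.setC S) *m ((b *: (C *m C^T)) *m D (finset.setC S)).
  apply/matrixP => i j; rewrite /D !(mul_diag_mx, mul_mx_diag) !mxE !inE.
  have -> : \sum_l C i l * C^T l j = (blk i == blk j)%:R.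
    rewrite (bigD1 (blk i)) //= big1 => [|l li].
      by rewrite !mxE eqxx mul1r addr0 eq_sym.
    by rewrite !mxE eq_sym (negPf li) mul0r.
  case: (boolP (i \in S)) => iS /=; first by rewrite !mul0r mul1r !addr0.
  case: (boolP (j \in S)) => jS /=; first by rewrite !(mul0r, mul1r, mulr1, mulr0) add0r addr0.
  by rewrite !(mul0r, mul1r, mulr1, mulr0) !add0r MS.
have rkS := rank_diag_mem F S.
rewrite addnC mul2n -addnn.
apply: leq_trans (mxrank_add _ _) _; apply: leq_add.
  apply: leq_trans (mxrank_add _ _) _; apply: leq_add.
    exact: leq_trans (mxrankM_maxl _ _) rkS.
  apply: leq_trans (mxrankM_maxr _ _) _.
  exact: leq_trans (mxrankM_maxr _ _) rkS.
apply: leq_trans (mxrankM_maxr _ _) _; apply: leq_trans (mxrankM_maxl _ _) _.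
apply: leq_trans (mxrank_scale _ _) _.
exact: leq_trans (mxrankM_maxl _ _) (rank_leq_col _).
Qed.

(** * Operators of hypergraphs that are uniform off a small vertex set *)

(* Away from S, G looks like k disjoint blocks, any two vertices of a block
   being co-oriented in a hyperedges. *)
Definition uniform_outside (V : finType) (k : nat) (blk : V -> 'I_k)
    (G : ohypergraph V) (S : {set V}) (d a : nat) : Prop :=
  [/\ forall i, i \notin S -> hdeg G i = d,
      forall i j, i \notin S -> j \notin S -> i != j ->
        #|[set h | co_oriented (G := G) i j h]%SET| = (a * (blk i == blk j))%N
    & forall i j, i \notin S -> j \notin S -> i != j ->
        #|[set h | anti_oriented (G := G) i j h]%SET| = 0%N].

(** The coefficient alpha of the identity in the entries off [S], for vertex degree [d] and [a]
    common hyperedges per pair in a block. *)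
Definition bulk_eigenvalue (R : realType) (Q : hoperator) (d a : nat) : R :=
  match Q with
  | OpA => a%:R
  | OpD => d%:R
  | OpK => d%:R - a%:R
  | OpL => 1 - (Num.sqrt d%:R)^-1 * a%:R * (Num.sqrt d%:R)^-1
  end.

Lemma rank_operator_mx (R : realType) (Q : hoperator) (V : finType) (k : nat)
    (blk : V -> 'I_k) (G : ohypergraph V) (S : {set V}) (d a : nat) :
  uniform_outside blk G S d a ->
  (\rank (operator_mx R Q G - (bulk_eigenvalue R Q d a)%:M)%R <= k + 2 * #|S|)%N.
Proof.
move=> [Hd Hco Hanti]; set S' := finset.preimset (@enum_val V V) (mem S).
have -> : #|S| = #|S'|.
  rewrite on_card_preimset //; exists enum_rank => i _; last exact: enum_rankK.
  exact: enum_valK.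
(* The zero diagonal of the adjacency matrix is the block constant [- a] corrected by [a] times the
   identity. *)
have HA (i j : 'I_#|V|) : i \notin S' -> j \notin S' ->
    adjacency_mx G R i j = a%:R * (i == j)%:R
      - a%:R * (blk (enum_val i) == blk (enum_val j))%:R.
  rewrite !inE !mxE => iS jS; case: eqVneq => [->|ij]; first by rewrite eqxx subrr.
  rewrite Hanti ?Hco ?(inj_eq enum_val_inj) //.
  by rewrite mulr0 natrM.
(* The coefficient beta of the same-block matrix that goes with each alpha. *)
pose b : R := match Q with
  | OpA => - a%:R
  | OpD => 0
  | OpK => a%:R
  | OpL => (Num.sqrt d%:R)^-1 * a%:R * (Num.sqrt d%:R)^-1
  end.
apply: (rank_block_outside (blk := blk \o enum_val) (b := b)) => i j iS jS.
have {}HA := HA i j iS jS.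
have di : hdeg G (enum_val i) = d by apply: Hd; rewrite inE in iS.
have dj : hdeg G (enum_val j) = d by apply: Hd; rewrite inE in jS.
rewrite mxE [X in _ + X]mxE [X in - X]mxE /b {b}; case: Q => /=.
- by rewrite HA; case: eqVneq => _ /=; ring.
- by rewrite !mxE di; case: eqVneq => _ /=; ring.
- rewrite (_ : kirchhoff_mx G R i j = degree_mx G R i j - adjacency_mx G R i j).
    by rewrite HA !mxE di; case: eqVneq => _ /=; ring.
  by rewrite !mxE.
- rewrite (_ : normalized_laplacian_mx G R i j = (i == j)%:R
    - (Num.sqrt (hdeg G (enum_val i))%:R)^-1 * adjacency_mx G R i j
      * (Num.sqrt (hdeg G (enum_val j))%:R)^-1).
    by rewrite HA di dj; case: eqVneq => _ /=; ring.
  by rewrite /normalized_laplacian_mx mul_mx_diag mul_diag_mx !mxE.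
Qed.

(** * Stability under altering few small hyperedges *)

(** Used for both hypergraphs with [F] the altered hyperedges, to reduce their counts to the shared
    labels [E]. *)
Lemma card_bij_sum (E F H : finType) (f : E + F -> H) (P : pred H) :
  bijective f -> (forall e, P (f (inr e)) = false) ->
  #|[set h | P h]%SET| = #|[set e | P (f (inl e))]%SET|.
Proof.
move=> fbij PF; rewrite -!sum1dep_card (reindex f) /=; last exact: onW_bij.
by rewrite big_sumType /= [X in (_ + X)%N]big1 ?addn0 // => e; rewrite PF.
Qed.

(** [S] is the union of all altered hyperedges. A vertex off [S] meets only shared hyperedges, so
    every count at such vertices is inherited from [G1]. *)
Lemma uniform_outside_differ (V : finType) (k : nat) (blk : V -> 'I_k)
    (G1 G2 : ohypergraph V) (d a c1 c2 : nat) :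
  uniform_outside blk G1 finset.set0 d a -> differ_at_most G1 G2 c1 c2 ->
  exists2 S : {set V}, (#|S| <= c1 * c2)%N & uniform_outside blk G2 S d a.
Proof.
move=> [Hd Hco Hanti] [E [E1 [E2 [f1 [f2 [f1b f2b [Hset Hor] cE [h1 h2]]]]]]].
pose S1 := (\bigcup_e hset (f1 (inr e)))%SET.
pose S2 := (\bigcup_e hset (f2 (inr e)))%SET.
have S1P i e : i \notin finset.setU S1 S2 -> i \in hset (f1 (inr e)) = false.
  by apply: contraNF => ie; rewrite finset.in_setU; apply/orP; left; apply/finset.bigcupP; exists e.
have S2P i e : i \notin finset.setU S1 S2 -> i \in hset (f2 (inr e)) = false.
  by apply: contraNF => ie; rewrite finset.in_setU; apply/orP; right; apply/finset.bigcupP; exists e.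
have cardU (J : finType) (F : J -> {set V}) :
    (forall e, (#|F e| <= c2)%N) -> (#|(\bigcup_e F e)%SET| <= #|J| * c2)%N.
  move=> Fc; rewrite -sum_nat_const.
  apply: (big_ind2 (fun (A : {set V}) n => (#|A| <= n)%N)) => [|A1 n1 A2 n2 h3 h4|i _ //].
    by rewrite cards0.
  by rewrite (leq_trans (leq_card_setU _ _).1) // leq_add.
exists (finset.setU S1 S2).
  rewrite (leq_trans (leq_card_setU _ _).1) //.
  by rewrite (leq_trans (leq_add (cardU _ _ h1) (cardU _ _ h2))) // -mulnDl leq_mul2r cE orbT.
split=> [i iS|i j iS jS ij|i j iS jS ij].
- rewrite -(Hd i) ?finset.in_set0 // /hdeg.
  rewrite (card_bij_sum f1b) => [|e]; last exact: S1P.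
  rewrite (card_bij_sum f2b) => [|e]; last exact: S2P.
  by apply: eq_card => e; rewrite !inE Hset.
- rewrite -(Hco i j) ?finset.in_set0 //.
  rewrite (card_bij_sum f1b) => [|e]; last by rewrite /co_oriented orient_neq0 S1P // andbF.
  rewrite (card_bij_sum f2b) => [|e]; last by rewrite /co_oriented orient_neq0 S2P // andbF.
  by apply: eq_card => e; rewrite !inE /co_oriented !Hor.
- rewrite -(Hanti i j) ?finset.in_set0 //.
  rewrite (card_bij_sum f1b) => [|e]; last by rewrite /anti_oriented orient_neq0 S1P // andbF.
  rewrite (card_bij_sum f2b) => [|e]; last by rewrite /anti_oriented orient_neq0 S2P // andbF.
  by apply: eq_card => e; rewrite !inE /anti_oriented !Hor.
Qed.

(** * Counting hyperedges in copies of the complete hypergraph *)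

(** Adjoining [X] is a bijection from the subsets of the complement of [X] of size [r - #|X|] to the
    sets counted, with inverse removal of [X]. *)
Lemma card_supersets (T : finType) (X : {set T}) (r : nat) : (#|X| <= r)%N ->
  #|[set h : {set T} | (#|h| == r) && (X \subset h)]%SET|
  = 'C(#|T| - #|X|, r - #|X|).
Proof.
move=> Xr; have -> : (#|T| - #|X|)%N = #|finset.setC X| by rewrite -(cardsC X) addKn.
rewrite -cards_draws -[RHS](card_in_imset (f := fun B => finset.setU X B)); last first.
  move=> A B; rewrite !inE => /andP[AX _] /andP[BX _] AB.
  have rm (C : {set T}) : C \subset finset.setC X -> finset.setD (finset.setU X C) X = C.
    move=> CX; apply/finset.setP => x; rewrite !inE; have := fintype.subsetP CX x.
    by rewrite inE; case: (x \in X) => //=; case: (x \in C) => // /(_ isT).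
  by rewrite -(rm A AX) -(rm B BX) AB.
apply: eq_card => h; apply/idP/imsetP => [|[B]].
  rewrite inE => /andP[/eqP hr Xh]; exists (finset.setD h X).
    rewrite inE finset.subsetDr // cardsD hr.
    by rewrite (finset.setIidPr Xh) eqxx.
  by rewrite -[Y in Y :|: _](finset.setIidPr Xh) finset.setID.
rewrite !inE => /andP[BX /eqP Br] ->; rewrite finset.subsetUl andbT.
rewrite cardsU Br (_ : finset.setI X B = finset.set0) ?cards0 ?subn0 ?subnKC //.
by apply/eqP; rewrite finset.setIC finset.setI_eq0 finset.disjoints_subset.
Qed.

(** Both sides are compared inside pairs of a copy index and a plain vertex set, where the labels
    embed injectively. *)
Lemma card_copies_edge (k n r : nat) (a : 'I_k) (p : pred {set 'I_n}) :
  #|[set h : 'I_k * rcomplete_edge r n | (a == h.1) && p (val h.2)]%SET|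
  = #|[set h : {set 'I_n} | (#|h| == r) && p h]%SET|.
Proof.
have vinj : injective (fun h : 'I_k * {h : {set 'I_n} | #|h| == r} => (h.1, val h.2)).
  by move=> [x y] [x' y'] [-> /val_inj ->].
have ainj : injective (pair a : {set 'I_n} -> 'I_k * {set 'I_n}) by move=> x y [].
rewrite -(card_imset _ vinj) -(card_imset _ ainj); apply: eq_card => h.
apply/imsetP/imsetP => [[[b x]]|[x]]; rewrite inE /=.
  by case/andP => /eqP <- px ->; exists (val x) => //; rewrite inE (valP x).
by case/andP => xr px ->; exists (a, Sub x xr) => //; rewrite inE /= eqxx.
Qed.

(** The binomials count the [r]-subsets through one and through two given vertices. Distinct copies
    share no hyperedge, and all orientations being +1 excludes anti-orientation. *)
Lemma uniform_disjoint_copies (k r n : nat) (r_ge2 : (2 <= r)%N) :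
  uniform_outside (@fst 'I_k 'I_n) (disjoint_copies k (rcomplete r_ge2 n))
    finset.set0 'C(n - 1, r - 1) 'C(n - 2, r - 2).
Proof.
split=> [[x i] _|[x i] [y j] _ _ ij|[x i] [y j] _ _ ij] /=.
- rewrite -[n in RHS]card_ord -(cards1 i) -card_supersets ?cards1; last exact: ltnW.
  rewrite -(card_copies_edge r x); apply: eq_card => h.
  by rewrite !inE /= finset.sub1set.
- case: (eqVneq x y) ij => [<-|xy] ij; last first.
    rewrite muln0; apply/eqP; rewrite cards_eq0; apply/eqP/finset.setP => -[z h].
    rewrite !inE /co_oriented /= /copies_orient /=.
    case: (eqVneq x z) => [<-|_]; last by rewrite eqxx andbF.
    by rewrite [y == x]eq_sym (negPf xy); case: eqP => // ->; rewrite eqxx.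
  have {}ij : i != j by apply: contraNneq ij => ->.
  rewrite muln1 -[n in RHS]card_ord.
  have c2 : #|[set i; j]%SET| = 2%N by rewrite cards2 ij.
  rewrite -c2 -card_supersets ?c2 // -(card_copies_edge r x); apply: eq_card => -[z h].
  rewrite !inE /co_oriented /= /copies_orient /= /rcomplete_orient.
  rewrite finset.subUset !finset.sub1set.
  by case: (eqVneq x z) => //= _; case: (i \in val h); case: (j \in val h).
- apply/eqP; rewrite cards_eq0; apply/eqP/finset.setP => -[z h].
  rewrite !inE /anti_oriented /= /copies_orient /= /rcomplete_orient.
  by case: (x == z); case: (y == z); case: (i \in val h); case: (j \in val h).
Qed.

(** * Convergence of the distance to zero *)

Theorem corollary5p10 (R : realType) (k r : nat) (k_ge1 : (1 <= k)%N)
    (r_ge2 : (2 <= r)%N)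
    (G2 : forall n : nat, ohypergraph ('I_k * 'I_n)%type)
    (c1 c2 : nat -> nat)
    (G2_deg : forall n : nat, (r <= n)%N -> no_isolated (G2 n))
    (G2_differ : forall n : nat, (r <= n)%N ->
       differ_at_most (disjoint_copies k (rcomplete r_ge2 n)) (G2 n)
         (c1 n) (c2 n))
    (c1c2 : (fun n : nat => (c1 n * c2 n)%:R : R^o)
              =o_\oo (fun n : nat => n%:R : R^o))
    (Q : hoperator) :
  dtv (spectral_measure
         (operator_mx R Q (disjoint_copies k (rcomplete r_ge2 n))))
      (spectral_measure (operator_mx R Q (G2 n))) @[n --> \oo]
    --> 0%E.
Proof.
(* The total variation bound for rank at most [k + 2 * (c1 n * c2 n)] and matrix size [k * n]. *)
pose u n : R := (2 * (k + 2 * (c1 n * c2 n)))%:R / (k * n)%:R.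
have u0 : u @ \oo --> (0 : R).
  have k0 : (0 < k%:R :> R) by rewrite ltr0n.
  apply/cvgr0Pnorm_le => e e0.
  (* [u n] is [2 / n] plus [4 * c1 n * c2 n / (k * n)]. Each term is at most [e / 2]: the first once
     [n >= 4 / e], the second once [c1 n * c2 n <= e / 8 * n], as [k >= 1]. *)
  have e8 : 0 < e / 8 by rewrite divr_gt0.
  move/eqoP : c1c2 => /(_ _ e8) small.
  near=> n.
  have n0 : (0 < n%:R :> R) by rewrite ltr0n; near: n; exact: nbhs_infty_gt.
  have nk : 4 / e <= n%:R by near: n; exact: nbhs_infty_ger.
  have cn : (c1 n * c2 n)%:R <= e / 8 * n%:R :> R.
    suff : `|(c1 n * c2 n)%:R : R| <= e / 8 * `|n%:R : R| by rewrite !ger0_norm.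
    by near: n; exact: small.
  rewrite ger0_norm; last by rewrite /u divr_ge0.
  rewrite /u natrM [(k * n)%:R]natrM natrD [(2 * (c1 n * c2 n))%:R]natrM.
  rewrite ler_pdivrMr ?mulr_gt0 //.
  have k1 : (1 <= k%:R :> R) by rewrite ler1n.
  move: nk; rewrite ler_pdivrMr // => nk.
  (* These two products are the nonlinear facts that make the goal linear for [lra]. *)
  have ken : 0 <= (k%:R - 1) * (e * n%:R) by rewrite mulr_ge0 ?subr_ge0 // mulr_ge0 // ltW.
  have kn4 : 0 <= k%:R * (n%:R * e - 4) by rewrite mulr_ge0 ?subr_ge0.
  lra.
apply: (@squeeze_cvge _ _ _ _ (fun=> 0%E) _ (EFin \o u)); last 2 first.
- exact: cvg_cst.
- by apply: cvg_EFin => //; exact: nearW.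
near=> n; rewrite dtv_ge0 /=.
have rn : (r <= n)%N by near: n; exact: nbhs_infty_ge.
have H1 := uniform_disjoint_copies k n r_ge2.
have [S cS H2] := uniform_outside_differ H1 (G2_differ n rn).
have := @dtv_spectral_measure R _ _ _ (bulk_eigenvalue R Q _ _)
  (k + 2 * (c1 n * c2 n)) (leq_trans (rank_operator_mx R Q H1) _)
  (leq_trans (rank_operator_mx R Q H2) _).
have -> : u n = (2 * (k + 2 * (c1 n * c2 n)))%:R / #|{: 'I_k * 'I_n}|%:R.
  by rewrite /u card_prod !card_ord.
apply.
  (* The unaltered copies are uniform off the empty set, so their rank bound is just [k]. *)
  by rewrite cards0 muln0 leq_add2l.
by rewrite leq_add2l leq_mul2l cS.
Unshelve. all: by end_near.
Qed.
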